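(* If $X$ is a Rothberger space satisfying ${\sf S}_1(\mathcal{G}_K,\mathcal{G}_\Gamma)$, then $X$ is productively Rothberger and productively Gerlits–Nagy.
   Context: All spaces are infinite ${\sf T}_1$ topological spaces. $\mathcal{G}_K$ is the family of all collections $\mathcal{U}$ of ${\sf G}_\delta$ subsets of $X$ with $X\notin\mathcal{U}$ such that each compact subset of $X$ is contained in some member of $\mathcal{U}$. $\mathcal{G}_\Gamma$ is the family of infinite collections $\mathcal{U}$ of ${\sf G}_\delta$ subsets of $X$ such that every infinite subcollection covers $X$. ${\sf S}_1(\mathcal{A},\mathcal{B})$: for each sequence $(A_n)$ of elements of $\mathcal{A}$ there are $B_n\in A_n$ with $\{B_n:n\in\mathbb{N}\}\in\mathcal{B}$. $\mathcal{O}$: open covers; $\Omega$: open covers $\mathcal{U}$ with $X\notin\mathcal{U}$ such that every finite subset of $X$ lies in some member; $\mathcal{O}^{gp}$: open covers $\mathcal{U}$ admitting a partition into pairwise disjoint finite sets $\mathcal{U}_n$ ($n\in\mathbb{N}$) such that each point lies in $\bigcup\mathcal{U}_n$ for all but finitely many $n$. Rothberger means ${\sf S}_1(\mathcal{O},\mathcal{O})$; Gerlits–Nagy means ${\sf S}_1(\Omega,\mathcal{O}^{gp})$. $X$ is productively ${\sf Q}$ if $X\times Y$ has ${\sf Q}$ for every space $Y$ with ${\sf Q}$. *)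

(* Defs.v *)
From Stdlib Require Import List Arith.
Import ListNotations.

Definition is_topology {X : Type} (op : (X -> Prop) -> Prop) : Prop :=
  op (fun _ => True) /\ op (fun _ => False) /\
  (forall F : (X -> Prop) -> Prop, (forall U, F U -> op U) ->
      op (fun x => exists U, F U /\ U x)) /\
  (forall U V, op U -> op V -> op (fun x => U x /\ V x)).

Definition T1 {X : Type} (op : (X -> Prop) -> Prop) : Prop :=
  forall x y : X, x <> y -> exists U, op U /\ U x /\ ~ U y.

Definition infinite_type (X : Type) : Prop :=
  ~ exists l : list X, forall x, In x l.

Definition prod_open {X Y : Type} (opX : (X -> Prop) -> Prop) (opY : (Y -> Prop) -> Prop)
  (W : X * Y -> Prop) : Prop :=
  forall p, W p -> exists U V, opX U /\ opY V /\ U (fst p) /\ V (snd p) /\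
    forall q, U (fst q) -> V (snd q) -> W q.

Definition family (X : Type) := (X -> Prop) -> Prop.

Definition covers {X : Type} (U : family X) : Prop :=
  forall x, exists V, U V /\ V x.

Definition open_cover {X : Type} (op : (X -> Prop) -> Prop) (U : family X) : Prop :=
  (forall V, U V -> op V) /\ covers U.

Definition no_full_member {X : Type} (U : family X) : Prop :=
  forall V, U V -> ~ (forall x, V x).

Definition finite_family {X : Type} (U : family X) : Prop :=
  exists l : list (X -> Prop), forall V, U V -> In V l.

Definition Omega {X : Type} (op : (X -> Prop) -> Prop) (U : family X) : Prop :=
  open_cover op U /\ no_full_member U /\
  forall l : list X, exists V, U V /\ forall x, In x l -> V x.

Definition Ogp {X : Type} (op : (X -> Prop) -> Prop) (U : family X) : Prop :=
  open_cover op U /\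
  exists P : nat -> list (X -> Prop),
    (forall n V, In V (P n) -> U V) /\
    (forall V, U V -> exists n, In V (P n)) /\
    (forall n m V, n <> m -> In V (P n) -> In V (P m) -> False) /\
    (forall x, exists N, forall n, N <= n -> exists V, In V (P n) /\ V x).

Definition Gdelta {X : Type} (op : (X -> Prop) -> Prop) (A : X -> Prop) : Prop :=
  exists G : nat -> (X -> Prop), (forall n, op (G n)) /\ forall x, A x <-> forall n, G n x.

Definition compact_subset {X : Type} (op : (X -> Prop) -> Prop) (K : X -> Prop) : Prop :=
  forall U : family X, (forall V, U V -> op V) ->
    (forall x, K x -> exists V, U V /\ V x) ->
    exists l : list (X -> Prop), (forall V, In V l -> U V) /\
      forall x, K x -> exists V, In V l /\ V x.

Definition G_K {X : Type} (op : (X -> Prop) -> Prop) (U : family X) : Prop :=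
  (forall V, U V -> Gdelta op V) /\ no_full_member U /\
  forall K, compact_subset op K -> exists V, U V /\ forall x, K x -> V x.

Definition G_Gamma {X : Type} (op : (X -> Prop) -> Prop) (U : family X) : Prop :=
  (forall V, U V -> Gdelta op V) /\ ~ finite_family U /\
  forall W : family X, (forall V, W V -> U V) -> ~ finite_family W -> covers W.

Definition S1 {X : Type} (A B : family X -> Prop) : Prop :=
  forall U : nat -> family X, (forall n, A (U n)) ->
    exists f : nat -> (X -> Prop), (forall n, U n (f n)) /\
      B (fun V => exists n, V = f n).

Definition Rothberger {X : Type} (op : (X -> Prop) -> Prop) : Prop :=
  S1 (open_cover op) (open_cover op).

Definition GerlitsNagy {X : Type} (op : (X -> Prop) -> Prop) : Prop :=
  S1 (Omega op) (Ogp op).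

(* Standing assumption: all spaces are infinite T1 spaces. *)
Definition space {X : Type} (op : (X -> Prop) -> Prop) : Prop :=
  is_topology op /\ T1 op /\ infinite_type X.

Definition productively {X : Type} (opX : (X -> Prop) -> Prop)
  (Q : forall Z : Type, ((Z -> Prop) -> Prop) -> Prop) : Prop :=
  forall (Y : Type) (opY : (Y -> Prop) -> Prop), space opY -> Q Y opY ->
    Q (X * Y)%type (prod_open opX opY).

(* Main.v *)
Require Import Defs.
From Stdlib Require Import List Arith.
From Stdlib Require Import Lia Cantor Classical ClassicalEpsilon IndefiniteDescription.
From Stdlib Require Import FunctionalExtensionality PropExtensionality.

(** Write the given sequence of open covers of X x Y as an array W(m,n,j).
    Fix m, a compact K and a point y.  The Rothberger property of X and the
    compactness of K give, in each row n, a finite selection covering a box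
    U x V with K in U and y in V.  These V form an open cover of Y for each n;
    a selection V(n) for Y thus yields a selection from W(m,-,-) which is good on
    G x Y, where G is the intersection of the corresponding U(n), a G_delta
    containing K.  Applying S_1(G_K, G_Gamma) to these families of G_delta sets
    (one for each m) combines countably many such selections into one for X x Y.
    As distinct rows use distinct covers, no game is needed.
    Both properties have the form "some selection w(n) is such that, for each point z,
    the set {n : z in w(n)} is large", and the argument works for any notion of
    largeness with two closure properties under pairing of indices. *)

(** * Arrays indexed by coded pairs, and injective choices from lists *)

Notation pair m n := (Cantor.to_nat (m, n)).

Lemma pair_inj a b c d : pair a b = pair c d -> a = c /\ b = d.
Proof.
  intros H. apply Cantor.to_nat_inj in H. now inversion H.
Qed.

Lemma pair_surj i : exists a b, i = pair a b.
Proof.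
  destruct (Cantor.of_nat i) as [a b] eqn:E. exists a, b.
  now rewrite <- E, Cantor.cancel_to_of.
Qed.

Lemma array_choice {A : Type} (R : nat -> A -> Prop) (w : nat -> nat -> A) :
  (forall m n, R (pair m n) (w m n)) ->
  exists f, (forall i, R i (f i)) /\ forall m n, f (pair m n) = w m n.
Proof.
  intros H. exists (fun i => w (fst (Cantor.of_nat i)) (snd (Cantor.of_nat i))).
  split.
  - intros i. destruct (pair_surj i) as (a & b & ->).
    rewrite Cantor.cancel_of_to. apply H.
  - intros m n. now rewrite Cantor.cancel_of_to.
Qed.

(** Pigeonhole: the [n] earlier choices cannot exhaust the [n+1] distinct entries of [l n], so a
    greedy choice always finds a new one. *)
Lemma injective_selection {A : Type} (l : nat -> list A) :
  (forall n, NoDup (l n) /\ length (l n) = S n) ->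
  exists c : nat -> A, (forall n, In (c n) (l n)) /\ forall n m, c n = c m -> n = m.
Proof.
  intros H.
  (* The length bound sits under the existential, so that choice yields a function on all pairs. *)
  assert (fresh : forall q : nat * list A, exists a,
            length (snd q) <= fst q -> In a (l (fst q)) /\ ~ In a (snd q)).
  { intros [n p]; simpl. destruct (H n) as [nd len].
    destruct (classic (exists a, In a (l n) /\ ~ In a p)) as [[a Ha] | none].
    - exists a. auto.
    - destruct (l n) as [|a t] eqn:E; [discriminate|]. exists a. intros le.
      assert (incl (a :: t) p).
      { intros x Hx. apply NNPP. intro. apply none. eauto. }
      apply NoDup_incl_length in H0; auto. lia. }
  apply functional_choice in fresh. destruct fresh as [F HF].
  pose (pre := fix pre n := match n with 0 => nil | S n => F (n, pre n) :: pre n end).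
  assert (len : forall n, length (pre n) = n) by (induction n; simpl; auto).
  assert (HF' : forall n, In (F (n, pre n)) (l n) /\ ~ In (F (n, pre n)) (pre n)).
  { intros n. apply (HF (n, pre n)). simpl. rewrite len. lia. }
  assert (old : forall n m, m < n -> In (F (m, pre m)) (pre n)).
  { induction n; intros m Hm; [lia|]. simpl.
    destruct (Nat.eq_dec m n) as [->|]; [now left | right; apply IHn; lia]. }
  exists (fun n => F (n, pre n)). split; [apply HF'|].
  intros n m E. destruct (lt_eq_lt_dec n m) as [[L|]|L]; auto; exfalso.
  - apply (proj2 (HF' m)). rewrite <- E. now apply old.
  - apply (proj2 (HF' n)). rewrite E. now apply old.
Qed.

(** * Finite unions and intersections of open sets *)

Lemma open_ext {X : Type} (op : (X -> Prop) -> Prop) (U V : X -> Prop) :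
  (forall x, U x <-> V x) -> op U -> op V.
Proof.
  intros H HU. replace V with U; auto.
  apply functional_extensionality. intros x. apply propositional_extensionality. auto.
Qed.

Lemma open_finite_union {X : Type} (op : (X -> Prop) -> Prop) (U : nat -> X -> Prop) b :
  is_topology op -> (forall j, op (U j)) -> op (fun x => exists j, j < b /\ U j x).
Proof.
  intros (_ & _ & un & _) H.
  apply (open_ext op (fun x => exists V, (exists j, j < b /\ V = U j) /\ V x)).
  - intros x. split.
    + intros (V & (j & Hj & ->) & Hx). eauto.
    + intros (j & Hj & Hx). exists (U j). eauto.
  - apply un. intros V (j & _ & ->). auto.
Qed.

Lemma open_finite_inter {X : Type} (op : (X -> Prop) -> Prop) (U : nat -> X -> Prop) b :
  is_topology op -> (forall j, op (U j)) -> op (fun x => forall j, j < b -> U j x).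
Proof.
  intros (full & _ & _ & int) H. induction b as [|b IH].
  - apply (open_ext op (fun _ => True)); auto. intros x. split; auto. intros _ j Hj. lia.
  - apply (open_ext op (fun x => (forall j, j < b -> U j x) /\ U b x)); auto.
    intros x. split.
    + intros [H1 H2] j Hj. destruct (Nat.eq_dec j b) as [->|]; auto. apply H1. lia.
    + intros H1. split; auto.
Qed.

Lemma infinite_inhabited {X : Type} : infinite_type X -> inhabited X.
Proof.
  intros H. apply NNPP. intros none. apply H. exists nil.
  intros x. exfalso. apply none. now constructor.
Qed.

(** * Notions of largeness for sets of indices *)

Definition largeness := (nat -> Prop) -> Prop.

(** [D] is chosen together with [w], because a grouping of the indices depends on the covers; [L]
    fixes the admissible kinds of largeness. *)
Definition selects (L : largeness -> Prop) {Z : Type} (op : (Z -> Prop) -> Prop) : Prop :=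
  forall U : nat -> family Z, (forall n, open_cover op (U n)) ->
    exists w D, L D /\ (forall n, U n (w n)) /\ forall z, D (fun n => w n z).

(** Serves when an index [n] of a selection for Y is replaced by a finite block of codes [pair n j],
    one of which catches the point. *)
Definition block_stable (L : largeness -> Prop) : Prop :=
  forall D (b : nat -> nat), L D -> exists D', L D' /\
    forall S S' : nat -> Prop, D S ->
      (forall n, S n -> exists j, j < b n /\ S' (pair n j)) -> D' S'.

(** Serves to merge the selections of all rows when each point is known to be caught largely in some
    row [m]. *)
Definition row_stable (L : largeness -> Prop) : Prop :=
  forall D : nat -> largeness, (forall m, L (D m)) -> exists D', L D' /\
    forall (S : nat -> Prop) m, D m (fun n => S (pair m n)) -> D' S.

(** * Selections on the product space *)

Section Products.
Variables (X Y : Type) (opX : (X -> Prop) -> Prop) (opY : (Y -> Prop) -> Prop).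
Hypotheses (topX : is_topology opX) (topY : is_topology opY).

Lemma prod_open_inter (U V : X * Y -> Prop) :
  prod_open opX opY U -> prod_open opX opY V -> prod_open opX opY (fun p => U p /\ V p).
Proof.
  destruct topX as (_ & _ & _ & iX), topY as (_ & _ & _ & iY).
  intros HU HV p [pU pV].
  destruct (HU p pU) as (A & B & oA & oB & pA & pB & HA).
  destruct (HV p pV) as (A' & B' & oA' & oB' & pA' & pB' & HA').
  exists (fun x => A x /\ A' x), (fun y => B y /\ B' y).
  repeat split; auto; [apply HA | apply HA']; tauto.
Qed.

Lemma prod_open_full : prod_open opX opY (fun _ => True).
Proof.
  intros p _. exists (fun _ => True), (fun _ => True).
  repeat split; auto; [apply topX | apply topY].
Qed.

Lemma finite_selection_on_box (K : X -> Prop) (W : nat -> family (X * Y)) (y : Y) :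
  Rothberger opX -> compact_subset opX K ->
  (forall j, open_cover (prod_open opX opY) (W j)) ->
  exists U V w b, opX U /\ opY V /\ (forall x, K x -> U x) /\ V y /\
    (forall j, W j (w j)) /\
    forall x y', U x -> V y' -> exists j, j < b /\ w j (x, y').
Proof.
  intros RX cK HW.
  (* The [j]-th cover of X consists of the open [U] forming with some neighbourhood of [y] a box
     inside one member of [W j]; [q] packs that neighbourhood and that member. *)
  destruct (RX (fun j U => opX U /\ exists q : (Y -> Prop) * (X * Y -> Prop),
      opY (fst q) /\ fst q y /\ W j (snd q) /\
      forall x y', U x -> fst q y' -> snd q (x, y'))) as (U & HU & oU & cU).
  { intros j. split; [tauto|]. intros x.
    destruct (HW j) as [op cov]. destruct (cov (x, y)) as (w & Ww & wxy).
    destruct (op w Ww (x, y) wxy) as (A & B & oA & oB & xA & yB & AB).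
    exists A. split; auto. split; auto. exists (B, w). simpl. repeat split; auto. }
  assert (HU' : forall j, exists q : (Y -> Prop) * (X * Y -> Prop),
      opY (fst q) /\ fst q y /\ W j (snd q) /\
      forall x y', U j x -> fst q y' -> snd q (x, y')) by (intros j; apply HU).
  apply functional_choice in HU'. destruct HU' as [q Hq].
  destruct (cK (fun V => exists n, V = U n)) as (l & Hl & lK); auto.
  assert (Hb : exists b, forall V, In V l -> exists j, j < b /\ V = U j).
  { clear lK. induction l as [|V l IH].
    - exists 0. intros V [].
    - destruct IH as [b Hb]; [intros; apply Hl; now right|].
      destruct (Hl V (or_introl eq_refl)) as [j Hj].
      exists (S (Nat.max b j)). intros V' [<- | HV'].
      + exists j. split; auto. lia.
      + destruct (Hb V' HV') as (i & Hi & E). exists i. split; auto. lia. }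
  destruct Hb as [b Hb].
  (* Compactness has left finitely many indices, so the neighbourhoods of [y] have an open
     intersection. *)
  exists (fun x => exists j, j < b /\ U j x), (fun y' => forall j, j < b -> fst (q j) y').
  exists (fun j => snd (q j)), b.
  split; [|split; [|split; [|split; [|split]]]].
  - apply open_finite_union; auto. intros j. apply HU.
  - apply open_finite_inter; auto. intros j. apply Hq.
  - intros x Kx. destruct (lK x Kx) as (V & lV & Vx).
    destruct (Hb V lV) as (j & Hj & ->). eauto.
  - intros j _. apply Hq.
  - intros j. apply Hq.
  - intros x y' (j & Hj & Ux) Vy. exists j. split; auto. apply Hq; auto.
Qed.

Lemma large_selection_on_Gdelta (L : largeness -> Prop) (K : X -> Prop)
  (W : nat -> family (X * Y)) :
  block_stable L -> selects L opY -> Rothberger opX -> compact_subset opX K ->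
  (forall n, open_cover (prod_open opX opY) (W n)) ->
  exists G w D, Gdelta opX G /\ (forall x, K x -> G x) /\ L D /\
    (forall n, W n (w n)) /\ forall x y, G x -> D (fun n => w n (x, y)).
Proof.
  intros bs LY RX cK HW.
  (* [q] packs the open set around [K], the selection from row [n], and the number of its members
     used on the box. *)
  destruct (LY (fun n V => opY V /\ exists q : (X -> Prop) * (nat -> X * Y -> Prop) * nat,
      opX (fst (fst q)) /\ (forall x, K x -> fst (fst q) x) /\
      (forall j, W (pair n j) (snd (fst q) j)) /\
      forall x y, fst (fst q) x -> V y -> exists j, j < snd q /\ snd (fst q) j (x, y)))
    as (v & D & LD & Hv & Dv).
  { intros n. split; [tauto|]. intros y.
    destruct (finite_selection_on_box K (fun j => W (pair n j)) y)
      as (U & V & w & b & oU & oV & KU & Vy & Ww & cov); auto.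
    exists V. split; auto. split; auto. now exists (U, w, b). }
  assert (Hv' : forall n, exists q : (X -> Prop) * (nat -> X * Y -> Prop) * nat,
      opX (fst (fst q)) /\ (forall x, K x -> fst (fst q) x) /\
      (forall j, W (pair n j) (snd (fst q) j)) /\
      forall x y, fst (fst q) x -> v n y -> exists j, j < snd q /\ snd (fst q) j (x, y))
    by (intros n; apply Hv).
  apply functional_choice in Hv'. destruct Hv' as [q Hq].
  destruct (array_choice W (fun n => snd (fst (q n)))) as (w & Ww & Ew).
  { intros n. apply Hq. }
  destruct (bs D (fun n => snd (q n)) LD) as (D' & LD' & HD').
  exists (fun x => forall n, fst (fst (q n)) x), w, D'.
  split; [|split; [|split; [|split]]]; auto.
  - exists (fun n => fst (fst (q n))). split; [|tauto]. intros n. apply Hq.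
  - intros x Kx n. now apply Hq.
  - intros x y Gx. apply HD' with (1 := Dv y). intros n vy.
    destruct (Hq n) as (_ & _ & _ & cov). destruct (cov x y (Gx n) vy) as (j & Hj & Hw).
    exists j. now rewrite Ew.
Qed.

Lemma selects_prod (L : largeness -> Prop) :
  block_stable L -> row_stable L -> selects L opY -> Rothberger opX ->
  S1 (G_K opX) (G_Gamma opX) -> selects L (prod_open opX opY).
Proof.
  intros bs rs LY RX GG W HW.
  pose (good := fun m G (q : (nat -> X * Y -> Prop) * largeness) =>
    L (snd q) /\ (forall n, W (pair m n) (fst q n)) /\
    forall x y, G x -> snd q (fun n => fst q n (x, y))).
  assert (local : forall m K, compact_subset opX K ->
    exists G, (Gdelta opX G /\ exists q, good m G q) /\ forall x, K x -> G x).
  { intros m K cK.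
    destruct (large_selection_on_Gdelta L K (fun n => W (pair m n)))
      as (G & w & D & dG & KG & LD & Ww & HD); auto.
    exists G. split; auto. split; auto. exists (w, D). unfold good. auto. }
  assert (Hf : exists f, (forall m, exists q, good m (f m) q) /\
                 forall x, exists m, f m x).
  (* A member of a [G_K] family must differ from X. If X itself is good for some row [m0], that row
     alone suffices and all other rows get the empty set. *)
  { destruct (classic (exists m0 G q, good m0 G q /\ forall x, G x))
      as [(m0 & G & q & Hq & fullG) | none].
    - exists (fun m x => m = m0). split; [|eauto].
      intros m. destruct (Nat.eq_dec m m0) as [->|ne].
      + exists q. destruct Hq as (? & ? & ?). split; auto.
      (* The empty compact set supplies some selection and largeness for row [m]. *)
      + destruct (local m (fun _ => False)) as (G' & (_ & q' & (? & ? & _)) & _).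
        { intros U _ _. exists nil. split; [intros V [] | tauto]. }
        exists q'. split; auto. split; auto. tauto.
    - destruct (GG (fun m G => Gdelta opX G /\ exists q, good m G q))
        as (f & Hf & _ & inf & cov).
      { intros m. split; [tauto | split].
        - intros V (_ & q & Hq) full. apply none. eauto.
        - apply local. }
      exists f. split; [intros m; apply Hf|]. intros x.
      (* The selected family is an infinite subfamily of itself, hence covers X. *)
      destruct (cov _ (fun V H => H) inf x) as (V & (m & ->) & Hx). eauto. }
  destruct Hf as (f & Hf & cov). apply functional_choice in Hf. destruct Hf as [q Hq].
  destruct (rs (fun m => snd (q m))) as (D' & LD' & HD'); [intros m; apply Hq|].
  destruct (array_choice W (fun m => fst (q m))) as (w & Ww & Ew); [intros m; apply Hq|].
  exists w, D'. repeat split; auto. intros [x y]. destruct (cov x) as [m fx].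
  apply (HD' _ m).
  replace (fun n => w (pair m n) (x, y)) with (fun n => fst (q m) n (x, y)).
  - now apply Hq.
  - apply functional_extensionality. intros n. now rewrite Ew.
Qed.

End Products.

(** * The Rothberger property as a selection property *)

Definition nonempty_large : largeness -> Prop := fun D => forall S, D S <-> exists n, S n.

Lemma nonempty_block_stable : block_stable nonempty_large.
Proof.
  intros D b LD. exists D. split; auto. intros S S' DS H.
  apply LD in DS. destruct DS as [n Hn]. destruct (H n Hn) as (j & _ & Hj).
  apply LD. eauto.
Qed.

Lemma nonempty_row_stable : row_stable nonempty_large.
Proof.
  intros D LD. exists (D 0). split; auto. intros S m DS.
  apply LD in DS. destruct DS as [n Hn]. apply LD. eauto.
Qed.

Lemma Rothberger_selects {Z : Type} (op : (Z -> Prop) -> Prop) :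
  Rothberger op <-> selects nonempty_large op.
Proof.
  split.
  - intros R U HU. destruct (R U HU) as (f & Hf & _ & cov).
    exists f, (fun S => exists n, S n). split; [now intros S|]. split; auto.
    intros z. destruct (cov z) as (V & (n & ->) & Hz). eauto.
  - intros R U HU. destruct (R U HU) as (f & D & LD & Hf & cov).
    exists f. split; auto. split.
    + intros V (n & ->). now apply (HU n).
    + intros z. destruct (proj1 (LD _) (cov z)) as [n Hn]. eauto.
Qed.

(** * Largeness given by disjoint finite groups of indices *)

(** The index version of the partition in [Ogp]: a set is large when it meets all but finitely many
    groups. Indices outside all groups are allowed. *)
Definition grouped_large : largeness -> Prop := fun D =>
  exists G : nat -> list nat,
    (forall k k' n, In n (G k) -> In n (G k') -> k = k') /\
    forall S, D S <-> exists N, forall k, N <= k -> exists n, In n (G k) /\ S n.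

(** Each index in a group is replaced by its block; blocks are finite, and disjoint for distinct
    indices, so the new groups are again finite and disjoint. *)
Lemma grouped_block_stable : block_stable grouped_large.
Proof.
  intros D b (G & dG & HD).
  pose (G' := fun k => flat_map (fun n => map (fun j => pair n j) (seq 0 (b n))) (G k)).
  assert (HG' : forall k i, In i (G' k) <-> exists n j, In n (G k) /\ j < b n /\ i = pair n j).
  { intros k i. unfold G'. rewrite in_flat_map. split.
    - intros (n & Hn & Hi). apply in_map_iff in Hi. destruct Hi as (j & <- & Hj).
      apply in_seq in Hj. exists n, j. repeat split; auto. lia.
    - intros (n & j & Hn & Hj & ->). exists n. split; auto. apply in_map_iff.
      exists j. split; auto. apply in_seq. lia. }
  exists (fun S => exists N, forall k, N <= k -> exists n, In n (G' k) /\ S n). split.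
  - exists G'. split; [|tauto]. intros k k' i Hi Hi'.
    apply HG' in Hi, Hi'. destruct Hi as (n & j & Hn & _ & ->).
    destruct Hi' as (n' & j' & Hn' & _ & E). apply pair_inj in E.
    destruct E as [<- _]. eauto.
  - intros S S' DS H. apply HD in DS. destruct DS as [N HN]. exists N. intros k Hk.
    destruct (HN k Hk) as (n & Hn & Sn). destruct (H n Sn) as (j & Hj & Hs).
    exists (pair n j). split; auto. apply HG'. eauto 6.
Qed.

(* A point caught by the groups of a single row m is caught by the k-th group below for
   almost all k, since that group contains the k-th group of each row up to k. *)
Lemma grouped_row_stable : row_stable grouped_large.
Proof.
  intros D LD. apply functional_choice in LD. destruct LD as [G HG].
  pose (H := fun k => flat_map (fun m => map (fun n => pair m n) (G m k)) (seq 0 (S k))).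
  assert (HH : forall k i, In i (H k) <-> exists m n, m <= k /\ In n (G m k) /\ i = pair m n).
  { intros k i. unfold H. rewrite in_flat_map. split.
    - intros (m & Hm & Hi). apply in_map_iff in Hi. destruct Hi as (n & <- & Hn).
      apply in_seq in Hm. exists m, n. repeat split; auto. lia.
    - intros (m & n & Hm & Hn & ->). exists m. split; [apply in_seq; lia|].
      apply in_map_iff. eauto. }
  exists (fun S => exists N, forall k, N <= k -> exists n, In n (H k) /\ S n). split.
  - exists H. split; [|tauto]. intros k k' i Hi Hi'.
    apply HH in Hi, Hi'. destruct Hi as (m & n & _ & Hn & ->).
    destruct Hi' as (m' & n' & _ & Hn' & E). apply pair_inj in E.
    destruct E as [<- <-]. destruct (HG m) as [dG _]. eauto.
  - intros S m DS. apply HG in DS. destruct DS as [N HN].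
    exists (Nat.max N m). intros k Hk. destruct (HN k) as (n & Hn & Sn); [lia|].
    exists (pair m n). split; auto. apply HH. exists m, n. repeat split; auto. lia.
Qed.

(** * The Gerlits-Nagy property as a selection property *)

Definition finite_unions {Z : Type} (U : nat -> family Z) : family Z := fun V =>
  exists q : (nat -> Z -> Prop) * nat, (forall j, U j (fst q j)) /\
    V = fun z => exists j, j < snd q /\ fst q j z.

(** The [j]-th cover takes care of the [j]-th point of a finite list, so as many covers as points
    suffice. *)
Lemma finite_unions_Omega {Z : Type} (op : (Z -> Prop) -> Prop) (U : nat -> family Z) :
  is_topology op -> inhabited Z -> (forall j, open_cover op (U j)) ->
  no_full_member (finite_unions U) -> Omega op (finite_unions U).
Proof.
  intros top [z0] HU nf.
  assert (fin : forall l, exists V, finite_unions U V /\ forall x, In x l -> V x).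
  { intros l.
    (* Beyond the end of the list the default point [z0] keeps the selection defined. *)
    assert (C : forall j, exists V, U j V /\ V (nth j l z0)) by (intros j; apply (HU j)).
    apply functional_choice in C. destruct C as [u Hu].
    exists (fun z => exists j, j < length l /\ u j z). split.
    - exists (u, length l). split; auto. intros j. apply Hu.
    - intros x Hx. destruct (In_nth l x z0 Hx) as (j & Hj & <-). exists j. split; auto.
      apply Hu. }
  split; [split|split]; auto.
  - intros V (q & Hq & ->). apply open_finite_union; auto. intros j. now apply (HU j).
  - intros x. destruct (fin (x :: nil)) as (V & HV & Vx). exists V. split; auto.
    apply Vx. now left.
Qed.

(* The covers form an array U(a,n,j).  Either every layer a contains a row with a finite
   selection covering the space, which then serves as the a-th group, or for some a the
   finite unions along the rows of layer a are Omega-covers. *)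
Lemma GerlitsNagy_selects {Z : Type} (op : (Z -> Prop) -> Prop) :
  is_topology op -> inhabited Z -> GerlitsNagy op -> selects grouped_large op.
Proof.
  intros top inh GN U HU.
  assert (dflt : forall i, exists V, U i V).
  { intros i. destruct inh as [z]. destruct (HU i) as [_ c]. destruct (c z) as (V & HV & _).
    eauto. }
  apply functional_choice in dflt. destruct dflt as [d Hd].
  pose (row := fun a n j => U (pair a (pair n j))).
  destruct (classic (exists a, forall n, no_full_member (finite_unions (row a n))))
    as [[a nf] | full].
  - destruct (GN (fun n => finite_unions (row a n))) as (f & Hf & _ & P & PS & _ & dP & cov).
    { intros n. apply finite_unions_Omega; auto. intros j. apply HU. }
    apply functional_choice in Hf. destruct Hf as [q Hq].
    (* The sets [f n] may repeat. Fixing one index per set makes disjoint groups of sets yield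
       disjoint groups of indices. *)
    assert (idx : forall V, exists n, (exists n', V = f n') -> V = f n).
    { intros V. destruct (classic (exists n, V = f n)) as [[n Hn]|no].
      - eauto.
      - exists 0. tauto. }
    apply functional_choice in idx. destruct idx as [idx Hidx].
    (* Layer [a] carries the members whose unions were selected; other layers take the default
       [d]. *)
    destruct (array_choice U (fun a' i => if Nat.eq_dec a' a
        then fst (q (fst (Cantor.of_nat i))) (snd (Cantor.of_nat i)) else d (pair a' i)))
      as (w & Ww & Ew).
    { intros m i. destruct (Nat.eq_dec m a) as [->|]; auto.
      destruct (pair_surj i) as (n & j & ->). rewrite Cantor.cancel_of_to. simpl.
      apply (Hq n). }
    pose (G := fun k => flat_map (fun V =>
      map (fun j => pair a (pair (idx V) j)) (seq 0 (snd (q (idx V))))) (P k)).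
    exists w, (fun S => exists N, forall k, N <= k -> exists n, In n (G k) /\ S n).
    split; [|split]; auto.
    + exists G. split; [|tauto]. unfold G. intros k k' i Hi Hi'.
      apply in_flat_map in Hi, Hi'. destruct Hi as (V & HV & Hi), Hi' as (V' & HV' & Hi').
      apply in_map_iff in Hi, Hi'. destruct Hi as (j & <- & _), Hi' as (j' & E & _).
      apply pair_inj in E. destruct E as [_ E]. apply pair_inj in E. destruct E as [E _].
      assert (V = V').
      { rewrite (Hidx V), (Hidx V'), E; eauto. }
      subst V'. apply NNPP. intro ne. eapply dP; eauto.
    + intros z. destruct (cov z) as [N HN]. exists N. intros k Hk.
      destruct (HN k Hk) as (V & HV & Vz).
      pose proof (Hidx V (PS _ _ HV)) as E. rewrite E in Vz.
      destruct (Hq (idx V)) as [_ EV]. rewrite EV in Vz. destruct Vz as (j & Hj & Hz).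
      exists (pair a (pair (idx V) j)). split.
      * unfold G. apply in_flat_map. exists V. split; auto. apply in_map_iff.
        exists j. split; auto. apply in_seq. lia.
      * rewrite Ew. destruct (Nat.eq_dec a a); [|tauto]. now rewrite Cantor.cancel_of_to.
  - assert (C : forall a, exists t : nat * ((nat -> Z -> Prop) * nat),
      (forall j, U (pair a (pair (fst t) j)) (fst (snd t) j)) /\
      forall z, exists j, j < snd (snd t) /\ fst (snd t) j z).
    { intros a. apply NNPP. intro no. apply full. exists a. intros n V (q & Hq & ->) F.
      apply no. exists (n, q). auto. }
    apply functional_choice in C. destruct C as [t Ht].
    destruct (array_choice U (fun a i => if Nat.eq_dec (fst (Cantor.of_nat i)) (fst (t a))
        then fst (snd (t a)) (snd (Cantor.of_nat i)) else d (pair a i)))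
      as (w & Ww & Ew).
    { intros a i. destruct (pair_surj i) as (n & j & ->). rewrite Cantor.cancel_of_to. simpl.
      destruct (Nat.eq_dec n (fst (t a))) as [->|]; auto. apply (Ht a). }
    pose (G := fun a => map (fun j => pair a (pair (fst (t a)) j)) (seq 0 (snd (snd (t a))))).
    exists w, (fun S => exists N, forall k, N <= k -> exists n, In n (G k) /\ S n).
    split; [|split]; auto.
    + exists G. split; [|tauto]. unfold G. intros k k' i Hi Hi'.
      apply in_map_iff in Hi, Hi'. destruct Hi as (j & <- & _), Hi' as (j' & E & _).
      apply pair_inj in E. symmetry. apply E.
    + intros z. exists 0. intros k _. destruct (Ht k) as [_ cov].
      destruct (cov z) as (j & Hj & Hz). exists (pair k (pair (fst (t k)) j)). split.
      * unfold G. apply in_map_iff. exists j. split; auto. apply in_seq. lia.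
      * rewrite Ew, Cantor.cancel_of_to. simpl. destruct (Nat.eq_dec _ _); tauto.
Qed.

(** Every member misses a point, so a member containing [z] and one missed point of each earlier
    member is new. *)
Lemma Omega_many_members {Z : Type} (op : (Z -> Prop) -> Prop) (W : family Z) (z : Z) n :
  Omega op W -> exists l, NoDup l /\ length l = n /\ forall w, In w l -> W w /\ w z.
Proof.
  intros (_ & nf & fin). induction n as [|n (l & nd & len & Hl)].
  - exists nil. repeat split; auto; try constructor; destruct H.
  - assert (C : forall w : Z -> Prop, exists x, W w -> ~ w x).
    { intros w. destruct (classic (W w)) as [Ww|].
      - destruct (not_all_ex_not _ _ (nf w Ww)) as [x Hx]. eauto.
      - exists z. tauto. }
    apply functional_choice in C. destruct C as [miss Hm].
    destruct (fin (z :: map miss l)) as (w & Ww & Hw).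
    exists (w :: l). split; [|split].
    + constructor; auto. intros lw. apply (Hm w Ww). apply Hw. right. now apply in_map.
    + simpl. auto.
    + intros w' [<- | H]; auto. split; auto. apply Hw. now left.
Qed.

(* Shrinking the n-th Omega-cover to intersections of n+1 distinct members leaves room to
   choose the selected members pairwise distinct, so that disjoint groups of indices
   become disjoint groups of sets. *)
Lemma selects_GerlitsNagy {Z : Type} (op : (Z -> Prop) -> Prop) :
  op (fun _ => True) -> (forall U V, op U -> op V -> op (fun z => U z /\ V z)) ->
  selects grouped_large op -> GerlitsNagy op.
Proof.
  intros full int sel W HW.
  destruct (sel (fun n V => op V /\ exists l, (NoDup l /\ length l = S n) /\
      forall w, In w l -> W n w /\ forall z, V z -> w z)) as (v & D & (G & dG & HD) & Hv & Dv).
  { intros n. split; [tauto|]. intros z.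
    destruct (Omega_many_members op (W n) z (S n) (HW n)) as (l & nd & len & Hl).
    exists (fun x => forall w, In w l -> w x). repeat split.
    - assert (op_l : forall w, In w l -> op w).
      { intros w Hw. apply (proj1 (HW n)). now apply Hl. }
      clear -full int op_l. induction l as [|w l IH].
      + apply (open_ext op (fun _ => True)); auto. intros x. split; auto. intros _ w [].
      + apply (open_ext op (fun x => w x /\ forall w, In w l -> w x)).
        * intros x. simpl. split.
          { intros [H1 H2] w' [<-|H]; [exact H1 | exact (H2 w' H)]. }
          intros H. split; [apply H; now left | intros w' H'; apply H; now right].
        * apply int; [apply op_l; now left | apply IH; intros; apply op_l; now right].
    - exists l. split; auto. intros w Hw. split; [now apply Hl | exact (fun x Hx => Hx w Hw)].
    - intros w Hw. now apply Hl. }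
  assert (Hv' : forall n, exists l, (NoDup l /\ length l = S n) /\
      forall w, In w l -> W n w /\ forall z, v n z -> w z) by (intros n; apply Hv).
  apply functional_choice in Hv'. destruct Hv' as [l Hl].
  destruct (injective_selection l) as (f & fl & finj); [intros n; apply Hl|].
  assert (Hf : forall n, W n (f n)) by (intros n; now apply (Hl n)).
  assert (vf : forall n z, v n z -> f n z) by (intros n z; now apply (Hl n)).
  exists f. split; auto.
  assert (cov : forall z, exists N, forall k, N <= k -> exists n, In n (G k) /\ f n z).
  { intros z. destruct (proj1 (HD _) (Dv z)) as [N HN]. exists N. intros k Hk.
    destruct (HN k Hk) as (n & Hn & Hz). eauto. }
  split.
  { split.
    - intros V (n & ->). now apply (proj1 (HW n)).
    - intros z. destruct (cov z) as [N HN]. destruct (HN N (le_n _)) as (n & _ & Hz). eauto. }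
  (* An index [k] in no group is added to the [k]-th group, so that the groups exhaust the selected
     family; enlarging groups preserves [cov]. *)
  pose (rest := fun k => if excluded_middle_informative (exists k', In k (G k'))
                         then nil else k :: nil).
  assert (Hrest : forall k n, In n (rest k) -> n = k /\ ~ exists k', In k (G k')).
  { unfold rest. intros k n. destruct excluded_middle_informative; simpl; [tauto|].
    intros [->|[]]. auto. }
  exists (fun k => map f (G k ++ rest k)). split; [|split; [|split]].
  - intros k V H. apply in_map_iff in H. destruct H as (n & <- & _). eauto.
  - intros V (n & ->). destruct (classic (exists k, In n (G k))) as [[k Hk] | no].
    + exists k. apply in_map, in_or_app. now left.
    + exists n. apply in_map, in_or_app. right. unfold rest.
      destruct excluded_middle_informative; [tauto | now left].
  - intros k k' V ne H H'. apply in_map_iff in H, H'.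
    (* Injectivity of [f] turns a common set into a common index. *)
    destruct H as (n & <- & H), H' as (n' & E & H'). apply finj in E. subst n'.
    apply in_app_or in H, H'.
    destruct H as [H|H], H' as [H'|H']; try (apply Hrest in H); try (apply Hrest in H');
      firstorder; subst; eauto.
  - intros z. destruct (cov z) as [N HN]. exists N. intros k Hk.
    destruct (HN k Hk) as (n & Hn & Hz). exists (f n). split; auto.
    apply in_map, in_or_app. now left.
Qed.

(** * Products with Rothberger and with Gerlits-Nagy spaces *)

Theorem theorem4p13 (X : Type) (opX : (X -> Prop) -> Prop) :
  space opX -> Rothberger opX -> S1 (G_K opX) (G_Gamma opX) ->
  productively opX (fun Z opZ => @Rothberger Z opZ) /\
  productively opX (fun Z opZ => @GerlitsNagy Z opZ).
Proof.
  intros (topX & _) RX GG. split; intros Y opY (topY & _ & infY) QY.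
  - apply Rothberger_selects. apply Rothberger_selects in QY.
    apply selects_prod; auto using nonempty_block_stable, nonempty_row_stable.
  - apply selects_GerlitsNagy.
    + now apply prod_open_full.
    + intros U V. now apply prod_open_inter.
    + apply selects_prod; auto using grouped_block_stable, grouped_row_stable.
      apply GerlitsNagy_selects; auto using infinite_inhabited.
Qed.
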